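(* Let $L$ be a distributive lattice and $\ell\in\mathbb{N}$. Then $L$ is of Krull dimension $\le\ell-1$ if and only if for all $x_1,\ldots,x_\ell\in L$ there exist $a_1,\ldots,a_\ell\in L$ such that $$a_1\wedge x_1=0,\quad a_2\wedge x_2\le a_1\vee x_1,\quad\ldots,\quad a_\ell\wedge x_\ell\le a_{\ell-1}\vee x_{\ell-1},\quad 1=a_\ell\vee x_\ell$$ (for $\ell=0$ the condition is read as $1=0$ in $L$).
   Context: Distributive lattices have a minimum $0$ and a maximum $1$; morphisms preserve $0,1,\wedge,\vee$. $\mathrm{Kr}_\ell(L)$ is the distributive lattice presented by generators $\varphi_i(x)$ for $0\le i\le\ell$, $x\in L$ (that is, $\ell+1$ disjoint copies of $L$), and the relations (where $A\vdash B$ stands for $\bigwedge A\le\bigvee B$): $\vdash\varphi_i(1)$; $\varphi_i(0)\vdash$; $\varphi_i(a),\varphi_i(b)\vdash\varphi_i(a\wedge b)$; $\varphi_i(a\vee b)\vdash\varphi_i(a),\varphi_i(b)$; $\varphi_i(a)\vdash\varphi_i(b)$ whenever $a\le b$ in $L$; $\varphi_{i+1}(a)\vdash\varphi_i(a)$ for $i<\ell$. Definition of Krull dimension: $L$ is of (Krull) dimension $\le\ell-1$ if for every sequence $x_1,\ldots,x_\ell\in L$ one has in $\mathrm{Kr}_\ell(L)$ $$\varphi_0(x_1)\wedge\cdots\wedge\varphi_{\ell-1}(x_\ell)\ \le\ \varphi_1(x_1)\vee\cdots\vee\varphi_\ell(x_\ell).$$ *)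

(* Defs.v *)
From HB Require Import structures.
From mathcomp Require Import all_boot all_order generic_quotient.
From mathcomp Require Import boolp.

Set Implicit Arguments.
Unset Strict Implicit.
Unset Printing Implicit Defensive.

Import Order.TTheory.
Local Open Scope order_scope.
Local Open Scope quotient_scope.

(* Bounded distributive lattices are [tbDistrLatticeType]s: minimum \bot,
   maximum \top, and \bot = \top is allowed. *)

Inductive term (G : Type) : Type :=
| TGen of G
| TBot
| TTop
| TMeet of term G & term G
| TJoin of term G & term G.

Arguments TBot {G}.
Arguments TTop {G}.

HB.instance Definition _ (G : Type) := gen_eqMixin (term G).
HB.instance Definition _ (G : Type) := gen_choiceMixin (term G).

(* A set of relations between the generators: R A B is the relation A |- B,
   i.e. the meet of the generators in A is below the join of those in B. *)
Definition relations (G : Type) : Type := seq G -> seq G -> Prop.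

Definition tmeets (G : Type) (A : seq G) : term G :=
  foldr (fun g t => TMeet (TGen g) t) TTop A.

Definition tjoins (G : Type) (B : seq G) : term G :=
  foldr (fun g t => TJoin (TGen g) t) TBot B.

(* The least preorder on terms making the quotient a bounded distributive
   lattice in which the relations R hold. *)
Inductive term_le (G : Type) (R : relations G) : term G -> term G -> Prop :=
| term_le_refl s : term_le R s s
| term_le_trans s t u : term_le R s t -> term_le R t u -> term_le R s u
| term_le_bot s : term_le R TBot s
| term_le_top s : term_le R s TTop
| term_le_meetl s t : term_le R (TMeet s t) s
| term_le_meetr s t : term_le R (TMeet s t) t
| term_le_meet s t u :
    term_le R s t -> term_le R s u -> term_le R s (TMeet t u)
| term_le_joinl s t : term_le R s (TJoin s t)
| term_le_joinr s t : term_le R t (TJoin s t)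
| term_le_join s t u :
    term_le R s u -> term_le R t u -> term_le R (TJoin s t) u
| term_le_distr s t u :
    term_le R (TMeet (TJoin s t) u) (TJoin (TMeet s u) (TMeet t u))
| term_le_rel A B : R A B -> term_le R (tmeets A) (tjoins B).

Section Presentation.
Context {G : Type} (R : relations G).
Implicit Types (s t u : term G) (A B : seq G).

Definition term_eqv : rel (term G) :=
  fun s t => `[< term_le R s t /\ term_le R t s >].

Lemma term_eqv_refl : reflexive term_eqv.
Proof. by move=> s; apply/asboolP; split; apply: term_le_refl. Qed.

Lemma term_eqv_sym : symmetric term_eqv.
Proof. by move=> s t; apply/asboolP/asboolP => -[]. Qed.

Lemma term_eqv_trans : transitive term_eqv.
Proof.
move=> t s u /asboolP[st ts] /asboolP[tu ut]; apply/asboolP.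
by split; [apply: term_le_trans st tu | apply: term_le_trans ut ts].
Qed.

Canonical term_eqv_equiv_rel :=
  EquivRel term_eqv term_eqv_refl term_eqv_sym term_eqv_trans.

Definition presented : Type := {eq_quot term_eqv}.

HB.instance Definition _ := Choice.on presented.
HB.instance Definition _ := EqQuotient.on presented.

Definition pclass (s : term G) : presented := \pi_presented s.

Definition pgen (g : G) : presented := pclass (TGen g).

Lemma pclassP s t : pclass s = pclass t <-> term_le R s t /\ term_le R t s.
Proof.
split=> [/eqmodP /asboolP //|st]; apply/eqmodP; exact/asboolP.
Qed.

Lemma pclass_repr (x : presented) : pclass (repr x) = x.
Proof. exact: reprK. Qed.

Definition ple (x y : presented) : bool := `[< term_le R (repr x) (repr y) >].
Definition pmeet (x y : presented) := pclass (TMeet (repr x) (repr y)).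
Definition pjoin (x y : presented) := pclass (TJoin (repr x) (repr y)).

Lemma ple_class s t : reflect (term_le R s t) (ple (pclass s) (pclass t)).
Proof.
have /pclassP[s1 s2] := pclass_repr (pclass s).
have /pclassP[t1 t2] := pclass_repr (pclass t).
apply: (iffP (asboolP _)) => h.
- exact: term_le_trans s2 (term_le_trans h t1).
- exact: term_le_trans s1 (term_le_trans h t2).
Qed.

Lemma ple_refl : reflexive ple.
Proof. by move=> x; apply/asboolP; apply: term_le_refl. Qed.

Lemma ple_anti : antisymmetric ple.
Proof.
move=> x y /andP[/asboolP xy /asboolP yx].
by rewrite -(pclass_repr x) -(pclass_repr y); apply/pclassP.
Qed.

Lemma ple_trans : transitive ple.
Proof.
move=> y x z /asboolP xy /asboolP yz; apply/asboolP.
exact: term_le_trans xy yz.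
Qed.

Fact presented_display : Order.disp_t. Proof. exact: Order.Disp tt tt. Qed.

HB.instance Definition _ := Order.Le_isPOrder.Build presented_display presented
  ple_refl ple_anti ple_trans.

Lemma pclass_le s t : pclass s <= pclass t <-> term_le R s t.
Proof. by split=> /ple_class. Qed.

Lemma pmeetP (x y z : presented) : (x <= pmeet y z) = (x <= y) && (x <= z).
Proof.
rewrite -[x]pclass_repr -[y in RHS]pclass_repr -[z in RHS]pclass_repr.
apply/ple_class/andP => [h|[/ple_class xy /ple_class xz]].
- by split; apply/ple_class; apply: term_le_trans h _;
    [apply: term_le_meetl | apply: term_le_meetr].
- exact: term_le_meet.
Qed.

Lemma pjoinP (x y z : presented) : (pjoin x y <= z) = (x <= z) && (y <= z).
Proof.
rewrite -[z]pclass_repr -[x in RHS]pclass_repr -[y in RHS]pclass_repr.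
apply/ple_class/andP => [h|[/ple_class xz /ple_class yz]].
- by split; apply/ple_class; apply: term_le_trans _ h;
    [apply: term_le_joinl | apply: term_le_joinr].
- exact: term_le_join.
Qed.

HB.instance Definition _ := Order.POrder_MeetJoin_isLattice.Build
  presented_display presented pmeetP pjoinP.

Lemma pclass_meet s t : pclass (TMeet s t) = pclass s `&` pclass t.
Proof.
apply/le_anti/andP; split.
- by rewrite lexI; apply/andP; split; apply/pclass_le;
    [apply: term_le_meetl | apply: term_le_meetr].
- rewrite -[leLHS]pclass_repr; apply/pclass_le; apply: term_le_meet.
  + by apply/pclass_le; rewrite pclass_repr leIl.
  + by apply/pclass_le; rewrite pclass_repr leIr.
Qed.

Lemma pclass_join s t : pclass (TJoin s t) = pclass s `|` pclass t.
Proof.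
apply/le_anti/andP; split.
- rewrite -[leRHS]pclass_repr; apply/pclass_le; apply: term_le_join.
  + by apply/pclass_le; rewrite pclass_repr leUl.
  + by apply/pclass_le; rewrite pclass_repr leUr.
- by rewrite leUx; apply/andP; split; apply/pclass_le;
    [apply: term_le_joinl | apply: term_le_joinr].
Qed.

Lemma pmeetUl : left_distributive (Order.meet : presented -> _) Order.join.
Proof.
move=> x y z; apply/le_anti/andP; split.
- rewrite -[x]pclass_repr -[y]pclass_repr -[z]pclass_repr.
  rewrite -!(pclass_meet, pclass_join).
  by apply/ple_class; apply: term_le_distr.
- by rewrite leUx !leI2 ?leUl ?leUr.
Qed.

HB.instance Definition _ := Order.Lattice_Meet_isDistrLattice.Build
  presented_display presented pmeetUl.

Lemma ple0x (x : presented) : pclass TBot <= x.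
Proof. by rewrite -[x]pclass_repr; apply/ple_class; apply: term_le_bot. Qed.

Lemma plex1 (x : presented) : x <= pclass TTop.
Proof. by rewrite -[x]pclass_repr; apply/ple_class; apply: term_le_top. Qed.

HB.instance Definition _ :=
  Order.hasBottom.Build presented_display presented ple0x.
HB.instance Definition _ :=
  Order.hasTop.Build presented_display presented plex1.

Lemma pgen_rel A B : R A B -> \meet_(g <- A) pgen g <= \join_(g <- B) pgen g.
Proof.
have -> : \meet_(g <- A) pgen g = pclass (tmeets A).
  by elim: A => [|g A IH]; rewrite ?big_nil // big_cons IH /= pclass_meet.
have -> : \join_(g <- B) pgen g = pclass (tjoins B).
  by elim: B => [|g B IH]; rewrite ?big_nil // big_cons IH /= pclass_join.
by move=> AB; apply/pclass_le; apply: term_le_rel.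
Qed.

(* Sanity check, not used in the definitions below: the universal property of
   the presented lattice.  Preservation of \bot and \top is spelled out because
   {tblmorphism _ -> _} does not entail preservation of meets and joins. *)

Fixpoint teval {d} {M : tbDistrLatticeType d} (f : G -> M) (t : term G) : M :=
  match t with
  | TGen g => f g
  | TBot => \bot
  | TTop => \top
  | TMeet s t => teval f s `&` teval f t
  | TJoin s t => teval f s `|` teval f t
  end.

Lemma presented_universal {d} {M : tbDistrLatticeType d} (f : G -> M) :
  (forall A B, R A B -> \meet_(g <- A) f g <= \join_(g <- B) f g) ->
  exists h : {lmorphism presented -> M},
    [/\ h \bot = \bot, h \top = \top & forall g, h (pgen g) = f g] /\
    (forall h' : {lmorphism presented -> M},
      h' \bot = \bot -> h' \top = \top -> (forall g, h' (pgen g) = f g) ->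
      h' =1 h).
Proof.
move=> fR.
have fE A : teval f (tmeets A) = \meet_(g <- A) f g.
  by elim: A => [|g A IH]; rewrite ?big_nil // big_cons -IH.
have fU B : teval f (tjoins B) = \join_(g <- B) f g.
  by elim: B => [|g B IH]; rewrite ?big_nil // big_cons -IH.
have fle s t : term_le R s t -> teval f s <= teval f t.
  elim=> //= {s t}.
  - by move=> s t u _ + _; apply: le_trans.
  - by move=> s t; rewrite leIl.
  - by move=> s t; rewrite leIr.
  - by move=> s t u _ st _ su; rewrite lexI st.
  - by move=> s t; rewrite leUl.
  - by move=> s t; rewrite leUr.
  - by move=> s t u _ su _ tu; rewrite leUx su.
  - by move=> s t u; rewrite meetUl.
  - by move=> A B /fR; rewrite fE fU.
pose h (x : presented) := teval f (repr x).
have hE s : h (pclass s) = teval f s.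
  have /pclassP[s1 s2] := pclass_repr (pclass s).
  by apply/le_anti/andP; split; apply: fle.
have h_le : {homo h : x y / x <= y} by move=> x y /asboolP /fle.
have hI : {morph h : x y / x `&` y >-> x `&` y}.
  move=> x y; rewrite -[x]pclass_repr -[y]pclass_repr -pclass_meet.
  by rewrite !hE.
have hU : {morph h : x y / x `|` y >-> x `|` y}.
  move=> x y; rewrite -[x]pclass_repr -[y]pclass_repr -pclass_join.
  by rewrite !hE.
have h0 : h \bot = \bot by rewrite [LHS]hE.
have h1 : h \top = \top by rewrite [LHS]hE.
pose h_ord := Order.isOrderMorphism.Build _ _ _ _ h h_le.
pose h_I := Order.isMeetLatticeMorphism.Build _ _ _ _ h hI.
pose h_U := Order.isJoinLatticeMorphism.Build _ _ _ _ h hU.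
pose H : {lmorphism presented -> M} := HB.pack h h_ord h_I h_U.
exists H; split=> [|h' h'0 h'1 h'f x].
  by split=> // g; apply: hE.
rewrite -[x]pclass_repr [RHS]hE; move: (repr x); elim=> //=.
- by move=> s IHs t IHt; rewrite pclass_meet -IHs -IHt; exact: omorphI.
- by move=> s IHs t IHt; rewrite pclass_join -IHs -IHt; exact: omorphU.
Qed.

End Presentation.

Arguments presented {G} R.
Arguments pgen {G} R g.

(* The generator phi_i(a) is encoded as the pair (i, a). *)
Inductive Kr_rel (d : Order.disp_t) (L : tbDistrLatticeType d) (l : nat) :
    relations ('I_l.+1 * L) :=
| Kr_top i : Kr_rel [::] [:: (i, \top)]
| Kr_bot i : Kr_rel [:: (i, \bot)] [::]
| Kr_meet i a b : Kr_rel [:: (i, a); (i, b)] [:: (i, a `&` b)]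
| Kr_join i a b : Kr_rel [:: (i, a `|` b)] [:: (i, a); (i, b)]
| Kr_le i a b : a <= b -> Kr_rel [:: (i, a)] [:: (i, b)]
| Kr_succ (i : 'I_l) a :
    Kr_rel [:: (lift ord0 i, a)] [:: (widen_ord (leqnSn l) i, a)].

Definition Kr (d : Order.disp_t) (L : tbDistrLatticeType d) (l : nat) :=
  presented (@Kr_rel d L l).

HB.instance Definition _ (d : Order.disp_t) (L : tbDistrLatticeType d) l :=
  Order.TBDistrLattice.on (Kr L l).

Definition Kr_phi (d : Order.disp_t) (L : tbDistrLatticeType d) (l : nat)
    (i : 'I_l.+1) (a : L) : Kr L l :=
  pgen (@Kr_rel d L l) (i, a).

(* [krull_dim_lt L l] is "L is of Krull dimension <= l - 1", where l - 1 is not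
   truncated.  Sequences are 0-indexed: x_1, ..., x_l are x 0, ..., x (l - 1),
   so that the i-th factor is phi_i(x_(i+1)) on the left and
   phi_(i+1)(x_(i+1)) on the right. *)
Definition krull_dim_lt (d : Order.disp_t) (L : tbDistrLatticeType d)
    (l : nat) : Prop :=
  forall x : 'I_l -> L,
    \meet_(i < l) Kr_phi (widen_ord (leqnSn l) i) (x i)
      <= \join_(i < l) Kr_phi (lift ord0 i) (x i).

Definition complementary (d : Order.disp_t) (L : tbDistrLatticeType d)
    (l : nat) : ('I_l -> L) -> ('I_l -> L) -> Prop :=
  match l with
  | 0 => fun _ _ => \top = \bot :> L
  | n.+1 => fun a x =>
      [/\ a ord0 `&` x ord0 = \bot,
          forall i j : 'I_n.+1, j = i.+1 :> nat ->
            a j `&` x j <= a i `|` x i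
        & \top = a ord_max `|` x ord_max]
  end.

(* Main.v *)
Require Import Defs.
From mathcomp Require Import all_boot all_order.

Set Implicit Arguments.
Unset Strict Implicit.
Unset Printing Implicit Defensive.

Import Order.TTheory.
Local Open Scope order_scope.

(** The theorem holds one sequence at a time, and is an instance of a
    description of all the inequalities between meets and joins of generators
    of [Kr L l] ([Kr_phi_leP]): the meet of the phi_i(A_i) is below the join of
    the phi_i(B_i) if and only if there are
    c_0 = 0, c_1, ..., c_l, c_(l+1) = 1 in [L] with
      A_i /\ c_(i+1) <= B_i \/ c_i   for 0 <= i <= l.
    Then one says that the pair (A, B) collapses. The theorem is the case
    A = (x_1, ..., x_l, 1), B = (0, x_1, ..., x_l), with a_i = c_i.

    If (A, B) collapses, the inequality follows by descending along
    phi_l(c_(l+1)), phi_(l-1)(c_l), ..., phi_0(c_1), phi_0(c_0).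

    For the converse a model of the relations is needed in which no further
    inequality holds. Read as sequents, the pairs (A, B) satisfy the rule that
    makes this possible, namely cut ([collapses_cut]): if (A, B) collapses
    both with x joined to B_i and with x met with A_i, then it collapses.
    The model consists of the sets of pairs that are regular for forcing: a pair
    is a condition, a pair with smaller A and larger B extends it, a pair that
    collapses counts as contradictory, and a pair (A, B) forces phi_i(x) when
    adding x to B_i makes it collapse, that is, when the sequent
    A |- B, phi_i(x) is derivable. Disjunction is interpreted by double negation
    relative to collapse, so that distributivity holds by a purely
    order-theoretic argument, without prime filters ([forces_sound]); the cut
    rule gives the relations of [Kr L l] ([forces_Kr_rel]). Now (A, B) forces
    each phi_i(A_i), hence, if the inequality holds in [Kr L l], the join of the
    phi_i(B_i); but a pair extending (A, B) that forces some phi_i(B_i)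
    collapses, so (A, B) itself collapses. *)

(** * Forcing for terms *)

Section Forcing.
Context {G T : Type} (ext : T -> T -> Prop) (abs : T -> Prop).
Context (V : G -> T -> Prop).
Implicit Types (s t u : term G) (p q r : T).

(** [ext q p] says that q extends p, and [abs] is the set of contradictory
    conditions, so [refutes X r] is the forcing clause for the negation of X. *)
Definition refutes (X : T -> Prop) r := forall q, ext q r -> X q -> abs q.

Fixpoint forces t : T -> Prop :=
  match t with
  | TGen g => V g
  | TBot => abs
  | TTop => fun=> True
  | TMeet s t => fun p => forces s p /\ forces t p
  | TJoin s t => fun p => forall r, ext r p ->
      refutes (forces s) r -> refutes (forces t) r -> abs r
  end.

Definition persistent (X : T -> Prop) := forall p q, ext q p -> X p -> X q.

(** The double negation of X implies X. *)
Definition regular (X : T -> Prop) :=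
  forall p, (forall r, ext r p -> refutes X r -> abs r) -> X p.

Context (ext_refl : forall p, ext p p).
Context (ext_trans : forall p q r, ext r q -> ext q p -> ext r p).
Context (abs_persistent : persistent abs).
Context (V_persistent : forall g, persistent (V g)).
Context (V_regular : forall g, regular (V g)).

Lemma refutes_persistent X : persistent (refutes X).
Proof. by move=> p r rp Xp q qr; apply: Xp; apply: ext_trans qr rp. Qed.

Lemma forces_persistent t : persistent (forces t).
Proof.
elim: t => [g| | |s IHs t IHt|s _ t _] p q qp //=.
- exact: V_persistent.
- exact: abs_persistent.
- by case=> sp tp; split; [apply: IHs sp | apply: IHt tp].
- by move=> stp r rq; apply: stp; apply: ext_trans rq qp.
Qed.

Lemma forces_regular t : regular (forces t).
Proof.
elim: t => [g| | |s IHs t IHt|s _ t _] p //=.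
- exact: V_regular.
- by move=> Hp; apply: Hp => // q.
- move=> Hp; split; [apply: IHs | apply: IHt] => r rp Hr; apply: Hp => //.
    by move=> q qr [sq _]; apply: Hr.
  by move=> q qr [_ tq]; apply: Hr.
- move=> Hp r rp sr tr; apply: Hp => // q qr; apply=> //.
    exact: refutes_persistent sr.
  exact: refutes_persistent tr.
Qed.

Lemma forces_joinl s t p : forces s p -> forces (TJoin s t) p.
Proof. by move=> sp r rp sr _; apply: sr => //; apply: forces_persistent sp. Qed.

Lemma forces_joinr s t p : forces t p -> forces (TJoin s t) p.
Proof. by move=> tp r rp _ tr; apply: tr => //; apply: forces_persistent tp. Qed.

(** The interpretation is a model of any presentation whose relations it
    satisfies: [forces_regular] gives the universal property of joins, and
    distributivity comes from [forces_persistent], because a condition that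
    forces u and refutes both s /\ u and t /\ u refutes s and t. *)
Lemma forces_sound (R : relations G) :
    (forall A B, R A B ->
      forall p, forces (tmeets A) p -> forces (tjoins B) p) ->
  forall s t, term_le R s t -> forall p, forces s p -> forces t p.
Proof.
move=> soundR s t; elim=> {s t}.
- by [].
- by move=> s t u _ st _ tu p /st /tu.
- move=> s p abs_p; apply: forces_regular => r rp _.
  exact: abs_persistent abs_p.
- by [].
- by move=> s t p [].
- by move=> s t p [].
- by move=> s t u _ st _ su p sp; split; [apply: st | apply: su].
- by move=> s t p; apply: forces_joinl.
- by move=> s t p; apply: forces_joinr.
- move=> s t u _ su _ tu p stp; apply: forces_regular => r rp ur.
  by apply: stp => // q qr fq; apply: ur => //; [apply: su | apply: tu].
- move=> s t u p [stp up] r rp sur tur; apply: stp => // q qr fq.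
    apply: sur => //; split=> //.
    by apply: forces_persistent up; apply: ext_trans qr rp.
  apply: tur => //; split=> //.
  by apply: forces_persistent up; apply: ext_trans qr rp.
- exact: soundR.
Qed.

End Forcing.

Section ForcingLists.
Context {G : eqType} {T : Type} (ext : T -> T -> Prop) (abs : T -> Prop).
Context (V : G -> T -> Prop) (ext_refl : forall p, ext p p).
Context (ext_trans : forall p q r, ext r q -> ext q p -> ext r p).

Lemma forces_tmeets A p :
  (forall g, g \in A -> V g p) -> forces ext abs V (tmeets A) p.
Proof.
elim: A => [|g A IH] //= VA; split; first by apply: VA; rewrite mem_head.
by apply: IH => h hA; apply: VA; rewrite in_cons hA orbT.
Qed.

Lemma forces_tjoins_abs B p :
    (forall g, g \in B -> refutes ext abs (V g) p) ->
  forces ext abs V (tjoins B) p -> abs p.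
Proof.
elim: B p => [|g B IH] p //= VB; apply=> //; first by apply: VB; rewrite mem_head.
move=> q qp; apply: IH => h hB; apply: refutes_persistent qp _ => //.
by apply: VB; rewrite in_cons hB orbT.
Qed.

End ForcingLists.

(** * Collapse and the cut rule *)

Lemma le_cut d (L : distrLatticeType d) (x y z : L) :
  x <= y `|` z -> x `&` y <= z -> x <= z.
Proof. by move=> /meet_idPl {2}<- xyz; rewrite meetUr leUx xyz leIr. Qed.

Section Collapse.
Context {d : Order.disp_t} {L : tbDistrLatticeType d} {l : nat}.
Implicit Types (i j : 'I_l.+1) (x y a b : L).

(** The pair (A, B) stands for the sequent with the phi_i(A_i) on the left and
    the phi_i(B_i) on the right. *)
Definition sequent : Type := ('I_l.+1 -> L) * ('I_l.+1 -> L).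
Implicit Types (p q r : sequent).

Definition weakens q p := forall i, (q.1 i <= p.1 i) && (p.2 i <= q.2 i).

Definition addl p i x : sequent :=
  (fun j => if j == i then p.1 j `&` x else p.1 j, p.2).

Definition addr p i x : sequent :=
  (p.1, fun j => if j == i then p.2 j `|` x else p.2 j).

Definition collapses p := exists c : nat -> L,
  [/\ c 0 = \bot, c l.+1 = \top &
      forall i, p.1 i `&` c i.+1 <= p.2 i `|` c i].

Lemma weakens_refl p : weakens p p.
Proof. by move=> i; rewrite !lexx. Qed.

Lemma weakens_trans p q r : weakens r q -> weakens q p -> weakens r p.
Proof.
move=> rq qp i; have /andP[r1 r2] := rq i; have /andP[q1 q2] := qp i.
by rewrite (le_trans r1 q1) (le_trans q2 r2).
Qed.

Lemma weakens_addl p i x : weakens (addl p i x) p.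
Proof. by move=> j; rewrite /= lexx andbT; case: eqP => // ->; rewrite leIl. Qed.

Lemma weakens_addr p i x : weakens (addr p i x) p.
Proof. by move=> j; rewrite /= lexx /=; case: eqP => // ->; rewrite leUl. Qed.

Lemma weakens_addl2 p q i x y :
  weakens q p -> x <= y -> weakens (addl q i x) (addl p i y).
Proof.
move=> qp xy j; have /andP[q1 q2] := qp j.
by rewrite /= q2 andbT; case: eqP => _ //; rewrite leI2.
Qed.

Lemma weakens_addr2 p q i x y :
  weakens q p -> y <= x -> weakens (addr q i x) (addr p i y).
Proof.
move=> qp yx j; have /andP[q1 q2] := qp j.
by rewrite /= q1 /=; case: eqP => _ //; rewrite leU2.
Qed.

Lemma weakens_addr_absorb p i x : x <= p.2 i -> weakens p (addr p i x).
Proof.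
by move=> xp j; rewrite /= lexx /=; case: eqP => // ->; rewrite leUx lexx.
Qed.

Lemma collapses_weakens : persistent weakens collapses.
Proof.
move=> p q qp [c [c0 cl cp]]; exists c; split=> // i; have /andP[q1 q2] := qp i.
by apply: le_trans (leI2 q1 (lexx _)) (le_trans (cp i) (leU2 q2 (lexx _))).
Qed.

Lemma collapses_id p i : p.1 i <= p.2 i -> collapses p.
Proof.
move=> pi.
(* Jumping from 0 to 1 at i leaves p.1 i <= p.2 i as the only condition. *)
exists (fun j : nat => if j <= i then \bot else \top)%N.
split=> [||j] //=; first by rewrite leqNgt ltn_ord.
case: (ltngtP j i) => [ji|ji|/val_inj->].
- by rewrite meetx0 le0x.
- by rewrite joinx1 lex1.
- by rewrite meetx1 joinx0.
Qed.

(** The two witnesses are joined up to the place of the cut and met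
    above it: away from i each inequality is then a consequence of the two given
    ones, and at i the distributive law eliminates x. *)
Lemma collapses_cut p i x :
  collapses (addr p i x) -> collapses (addl p i x) -> collapses p.
Proof.
move=> [c [c0 cl cp]] [e [e0 el ep]].
exists (fun j : nat => if j <= i then c j `|` e j else c j `&` e j)%N.
split=> [||j]; first by rewrite c0 e0 joinxx.
  by rewrite leqNgt ltn_ord /= cl el meetxx.
have {cp} := cp j; have {ep} := ep j => /=.
case: (ltngtP j i) => [ji|ji|/val_inj->].
- rewrite -val_eqE ltn_eqF //= => ep cp.
  by rewrite meetUr leUx (le_trans cp) ?(le_trans ep) ?leU2 ?leUl ?leUr.
- rewrite -val_eqE gtn_eqF //= => ep cp.
  by rewrite joinIr lexI (le_trans _ cp) ?(le_trans _ ep) ?leI2 ?leIl ?leIr.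
- rewrite eqxx => ep cp; apply: (@le_cut _ _ _ x).
    apply: le_trans (leI2 (lexx _) (leIl _ _)) (le_trans cp _).
    by rewrite joinAC joinC leU2 // leU2 // leUl.
  rewrite meetAC; apply: le_trans (leI2 (lexx _) (leIr _ _)) (le_trans ep _).
  by rewrite leU2 // leUr.
Qed.

(** * The forcing model of Kr *)

Definition derives (g : 'I_l.+1 * L) p := collapses (addr p g.1 g.2).

Lemma derives_persistent g : persistent weakens (derives g).
Proof. by move=> p q qp; apply: collapses_weakens; apply: weakens_addr2. Qed.

Lemma derives_regular g : regular weakens collapses (derives g).
Proof.
case: g => i x p; apply; first exact: weakens_addr.
move=> q qp; apply: collapses_weakens; apply: weakens_addr_absorb.
by have /andP[_] := qp i; rewrite /= eqxx; apply: le_trans; rewrite leUr.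
Qed.

(** Cuts on a and on b reduce this to the identity on a /\ b. *)
Lemma derives_meet i a b p :
  derives (i, a) p -> derives (i, b) p -> derives (i, a `&` b) p.
Proof.
move=> pa pb; set q := addr p i (a `&` b).
apply: (@collapses_cut q i a).
  by apply: collapses_weakens pa; apply: weakens_addr2 => //; apply: weakens_addr.
apply: (@collapses_cut _ i b).
  apply: collapses_weakens pb; apply: weakens_addr2 => //.
  exact: weakens_trans (weakens_addl _ _ _) (weakens_addr _ _ _).
apply: (@collapses_id _ i); rewrite /= !eqxx -meetA.
exact: le_trans (leIr _ _) (leUr _ _).
Qed.

Lemma derives_join i a b p :
    derives (i, a `|` b) p ->
  collapses (addl p i a) -> collapses (addl p i b) -> collapses p.
Proof.
move=> pab pa pb; apply: collapses_cut pa; apply: (@collapses_cut _ i b).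
  apply: collapses_weakens pab => j; rewrite /= lexx /=.
  by case: eqP => // ->; rewrite joinA.
by apply: collapses_weakens pb; apply: weakens_addl2 => //; apply: weakens_addr.
Qed.

(** Replacing c_(i+1) by c_(i+1) \/ a moves a from B_(i+1) to B_i. *)
Lemma derives_succ (i : 'I_l) a p :
  derives (lift ord0 i, a) p -> derives (widen_ord (leqnSn l) i, a) p.
Proof.
move=> [c [c0 cl cp]].
exists (fun j : nat => if j == i.+1 then c j `|` a else c j); split=> // [|j].
  by rewrite cl join1x; case: ifP.
have {cp} := cp j; rewrite /= -!val_eqE /= /bump /= add1n eqSS.
case: (eqVneq (j : nat) i) => [->|ji].
  rewrite ltn_eqF // => cp.
  rewrite meetUr leUx (le_trans cp) ?leU2 ?leUl //=.
  by rewrite (le_trans (leIr _ _)) // joinAC leUr.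
by case: eqP => // _; rewrite joinAC joinA.
Qed.

Local Notation Kr_forces := (forces weakens collapses derives).

Lemma forces_Kr_rel A B : Kr_rel A B ->
  forall p, Kr_forces (tmeets A) p -> Kr_forces (tjoins B) p.
Proof.
have joinl g t p : derives g p -> Kr_forces (TJoin (TGen g) t) p.
  exact: (forces_joinl weakens_refl weakens_trans collapses_weakens
    derives_persistent (s := TGen g)).
case=> {A B} [i|i|i a b|i a b|i a b ab|i a] p.
- move=> _; apply: joinl; apply: (@collapses_id _ i).
  by rewrite /= eqxx joinx1 lex1.
- case=> pi _; apply: collapses_weakens pi; apply: weakens_addr_absorb.
  exact: le0x.
- by case=> pa [pb _]; apply: joinl; apply: derives_meet.
- case=> pab _ r rp ra rb; apply: (@derives_join i a b).
  + exact: derives_persistent pab.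
  + apply: ra (weakens_addl _ _ _) _; apply: (@collapses_id _ i).
    by rewrite /= eqxx (le_trans (leIr _ _)) // leUr.
  + apply: rb (weakens_addl _ _ _) _; apply: (joinl (i, b) TBot).
    apply: (@collapses_id _ i).
    by rewrite /= eqxx (le_trans (leIr _ _)) // leUr.
- case=> pa _; apply: joinl; apply: collapses_weakens pa.
  exact: weakens_addr2 (weakens_refl _) ab.
- by case=> pa _; apply: joinl; apply: derives_succ.
Qed.

End Collapse.

(** * Inequalities between generators of Kr *)

Lemma pclass_tmeets G (R : relations G) A :
  pclass R (tmeets A) = \meet_(g <- A) pgen R g.
Proof.
by elim: A => [|g A IH]; rewrite ?big_nil // big_cons -IH /= pclass_meet.
Qed.

Lemma pclass_tjoins G (R : relations G) B :
  pclass R (tjoins B) = \join_(g <- B) pgen R g.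
Proof.
by elim: B => [|g B IH]; rewrite ?big_nil // big_cons -IH /= pclass_join.
Qed.

Section KrInequalities.
Context {d : Order.disp_t} {L : tbDistrLatticeType d} {l : nat}.
Local Notation phi := (@Kr_phi d L l).

Lemma Kr_phi_top i : phi i \top = \top.
Proof.
apply/eqP; rewrite -le1x.
by have := pgen_rel (@Kr_top d L l i); rewrite big_nil big_seq1.
Qed.

Lemma Kr_phi_bot i : phi i \bot = \bot.
Proof.
apply/eqP; rewrite -lex0.
by have := pgen_rel (@Kr_bot d L l i); rewrite big_nil big_seq1.
Qed.

Lemma Kr_phi_meet i a b : phi i a `&` phi i b <= phi i (a `&` b).
Proof.
by have := pgen_rel (@Kr_meet d L l i a b); rewrite big_cons !big_seq1.
Qed.

Lemma Kr_phi_join i a b : phi i (a `|` b) <= phi i a `|` phi i b.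
Proof.
by have := pgen_rel (@Kr_join d L l i a b); rewrite big_seq1 big_cons big_seq1.
Qed.

Lemma Kr_phi_le i a b : a <= b -> phi i a <= phi i b.
Proof.
by move=> ab; have := pgen_rel (@Kr_le d L l i a b ab); rewrite !big_seq1.
Qed.

Lemma Kr_phi_succ (i : 'I_l) a :
  phi (lift ord0 i) a <= phi (widen_ord (leqnSn l) i) a.
Proof. by have := pgen_rel (@Kr_succ d L l i a); rewrite !big_seq1. Qed.

(** Since A_i /\ c_(i+1) <= B_i \/ c_i, the bound phi_i(c_(i+1)) on the meet can
    be replaced, modulo the join, by phi_i(c_i) and then by phi_(i-1)(c_i),
    the bound at the next lower index; this leads from phi_l(1) to phi_0(0). *)
Lemma collapses_Kr_le (A B : 'I_l.+1 -> L) : collapses (A, B) ->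
  \meet_i phi i (A i) <= \join_i phi i (B i).
Proof.
move=> [c [c0 cl /= cAB]]; set M := \meet_i _; set J := \join_i _.
have step i : M <= phi i (c i.+1) `|` J -> M <= phi i (c i) `|` J.
  move=> Mc; apply: (@le_cut _ _ _ (phi i (A i `&` c i.+1))).
    have MA : M <= phi i (A i) by apply: meets_inf.
    apply: le_trans (_ : _ <= (phi i (A i) `&` phi i (c i.+1)) `|` J) _.
      by rewrite joinIl lexI Mc andbT (le_trans MA) ?leUl.
    by rewrite leU2 ?Kr_phi_meet ?leUr.
  apply: le_trans (leIr _ _) (le_trans (Kr_phi_le i (cAB i)) _).
  apply: le_trans (Kr_phi_join _ _ _) _; rewrite joinC leU2 //.
  exact: (joins_sup (fun j => phi j (B j))).
suff high i : M <= phi i (c i.+1) `|` J.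
  by have := step _ (high ord0); rewrite c0 Kr_phi_bot join0x.
have [m] := ubnP (l - i); elim: m i => // m IH i lt_im.
have [il|li] := ltnP i l; last first.
  have -> : i.+1 = l.+1 by apply/eqP; rewrite eqn_leq ltn_ord ltnS li.
  by rewrite cl Kr_phi_top join1x lex1.
have -> : i = widen_ord (leqnSn l) (Ordinal il) by apply: val_inj.
apply: le_trans (step (lift ord0 (Ordinal il)) (IH _ _)) _.
  by rewrite /= /bump /= add1n subnS -ltnS prednK // subn_gt0.
by rewrite leU2 // Kr_phi_succ.
Qed.

(** The pair (A, B) is itself the condition at which the model is evaluated: it
    forces the meet by [collapses_id], and forcing the join makes it collapse
    because the B_i already belong to it. *)
Lemma Kr_le_collapses (A B : 'I_l.+1 -> L) :
  \meet_i phi i (A i) <= \join_i phi i (B i) -> collapses (A, B).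
Proof.
pose gens (C : 'I_l.+1 -> L) := [seq (i, C i) | i : 'I_l.+1].
have -> : \meet_i phi i (A i) = pclass (@Kr_rel d L l) (tmeets (gens A)).
  by rewrite pclass_tmeets big_map big_enum.
have -> : \join_i phi i (B i) = pclass (@Kr_rel d L l) (tjoins (gens B)).
  by rewrite pclass_tjoins big_map big_enum.
move=> /pclass_le AB.
have joinsB : forces weakens collapses derives (tjoins (gens B)) (A, B).
  apply: forces_sound AB _ _.
  - exact: weakens_refl.
  - exact: weakens_trans.
  - exact: collapses_weakens.
  - exact: derives_persistent.
  - exact: derives_regular.
  - exact: forces_Kr_rel.
  - apply: forces_tmeets => _ /imageP[i _ ->]; apply: (@collapses_id _ _ _ _ i).
    by rewrite /= eqxx leUr.
apply: forces_tjoins_abs joinsB.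
- exact: weakens_refl.
- exact: weakens_trans.
- move=> _ /imageP[i _ ->] q qp; apply: collapses_weakens.
  by apply: weakens_addr_absorb; have /andP[] := qp i.
Qed.

(** Since each phi_i is a lattice morphism, one element of [L] per index on each
    side covers all the inequalities between finite meets and finite joins of
    generators. *)
Lemma Kr_phi_leP (p : sequent) :
  \meet_i phi i (p.1 i) <= \join_i phi i (p.2 i) <-> collapses p.
Proof.
by case: p => A B; split; [apply: Kr_le_collapses | apply: collapses_Kr_le].
Qed.

End KrInequalities.

(** * Complementary sequences *)

Section Complementary.
Context {d : Order.disp_t} {L : tbDistrLatticeType d} {l : nat}.
Implicit Types x : 'I_l -> L.

(** The sequences (x_1, ..., x_l, 1) and (0, x_1, ..., x_l): unlift removes the
    last index on the left, the first one on the right. *)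
Definition krull_sequent x : @sequent d L l :=
  (fun i => oapp x \top (unlift ord_max i), fun i => oapp x \bot (unlift ord0 i)).

Lemma krull_sequent_widen x (i : 'I_l) :
  (krull_sequent x).1 (widen_ord (leqnSn l) i) = x i.
Proof.
have -> : widen_ord (leqnSn l) i = lift ord_max i.
  by apply: val_inj; rewrite /= /bump leqNgt ltn_ord.
by rewrite /krull_sequent /= liftK.
Qed.

Lemma krull_sequent_max x : (krull_sequent x).1 ord_max = \top.
Proof. by rewrite /krull_sequent /= unlift_none. Qed.

Lemma krull_sequent_lift x (i : 'I_l) :
  (krull_sequent x).2 (lift ord0 i) = x i.
Proof. by rewrite /krull_sequent /= liftK. Qed.

Lemma krull_sequent_0 x : (krull_sequent x).2 ord0 = \bot.
Proof. by rewrite /krull_sequent /= unlift_none. Qed.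

Lemma krull_sequentP x :
  \meet_(i < l) Kr_phi (widen_ord (leqnSn l) i) (x i)
    <= \join_(i < l) Kr_phi (lift ord0 i) (x i) <->
  collapses (krull_sequent x).
Proof.
rewrite -Kr_phi_leP big_ord_recr big_ord_recl.
rewrite krull_sequent_max krull_sequent_0 Kr_phi_top Kr_phi_bot.
rewrite (eq_bigr _ (fun i _ => congr1 _ (krull_sequent_widen x i))).
rewrite (eq_bigr _ (fun i _ => congr1 _ (krull_sequent_lift x i))).
by rewrite /= meetx1 join0x.
Qed.

End Complementary.

(** The inequalities of a collapse of [krull_sequent x] are those of a
    complementary sequence (c_1, ..., c_l), completed by c_0 = 0 and
    c_(l+1) = 1; for l = 0 the only one is 1 <= 0. *)
Lemma krull_sequent_complementary d (L : tbDistrLatticeType d) l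
    (x : 'I_l -> L) :
  collapses (krull_sequent x) <-> exists a, complementary a x.
Proof.
case: l x => [|n] x.
  split=> [[c [c0 c1 /(_ ord0)]]|[_ /= top_bot]]; last first.
    exists (fun=> \bot); split=> // i.
    by rewrite -top_bot joinx1 lex1.
  rewrite krull_sequent_0 [X in _.1 X](_ : _ = ord_max); last exact: val_inj.
  rewrite krull_sequent_max c0 c1 meetxx joinxx lex0 => /eqP top_bot.
  by exists x.
split=> [[c [c0 cl cx]]|[a [ax0 axS axn]]].
  exists (fun i => c i.+1); split=> [|i j ij|].
  - have := cx ord0; rewrite krull_sequent_0 c0 joinxx lex0 meetC.
    rewrite [X in _.1 X](_ : _ = widen_ord (leqnSn _) ord0); last exact: val_inj.
    by rewrite krull_sequent_widen => /eqP.
  - have := cx (widen_ord (leqnSn _) j); rewrite krull_sequent_widen.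
    rewrite [X in _.2 X](_ : _ = lift ord0 i); last exact: val_inj.
    by rewrite krull_sequent_lift /= ij meetC joinC.
  - apply/esym/eqP; rewrite -le1x; have := cx ord_max.
    rewrite krull_sequent_max cl meetxx.
    rewrite [X in _.2 X](_ : _ = lift ord0 ord_max); last exact: val_inj.
    by rewrite krull_sequent_lift joinC.
(* The default value of oapp provides c_(l+1) = 1. *)
exists (fun j => if j is k.+1 then oapp a \top (insub k) else \bot).
split=> [||i] //; first by rewrite insubF ?ltnn.
have [j ->|->] := unliftP ord0 i; last first.
  rewrite krull_sequent_0.
  rewrite [X in _.1 X](_ : _ = widen_ord (leqnSn _) ord0); last exact: val_inj.
  rewrite krull_sequent_widen insubT /= meetC.
  by rewrite [X in a X](_ : _ = ord0) ?ax0 ?le0x //; apply: val_inj.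
rewrite krull_sequent_lift; have [jn|nj] := ltnP j n.
  pose k : 'I_n.+1 := Ordinal (jn : j.+1 < n.+1)%N.
  rewrite (_ : lift ord0 j = widen_ord (leqnSn _) k); last exact: val_inj.
  rewrite krull_sequent_widen /= (valK k) (valK j) /=.
  by rewrite meetC joinC axS.
have -> : j = ord_max by apply/val_inj/eqP; rewrite eqn_leq nj -ltnS ltn_ord.
by rewrite /= /bump /= add1n (valK (ord_max : 'I_n.+1)) joinC -axn lex1.
Qed.

Theorem theorem2p9 (d : Order.disp_t) (L : tbDistrLatticeType d) (l : nat) :
  krull_dim_lt L l <->
  forall x : 'I_l -> L, exists a : 'I_l -> L, complementary a x.
Proof.
by split=> H x; [rewrite -krull_sequent_complementary -krull_sequentP
  | rewrite krull_sequentP krull_sequent_complementary]; apply: H.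
Qed.
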